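(* For a (Hausdorff) topological space $X$, the following are equivalent: (a) Every convex-valued open relation $\Phi:X\leadsto\mathbb{R}$ has a continuous selection. (b) If $\xi:X\to\mathbb{R}$ is upper semicontinuous, $\eta:X\to\mathbb{R}$ is lower semicontinuous and $\xi<\eta$, then there is a continuous function $f:X\to\mathbb{R}$ with $\xi<f<\eta$.
   Context: All topological spaces are assumed Hausdorff. For a relation $\Phi\subset X\times Y$, $\Phi(x)=\{y\in Y:\langle x,y\rangle\in\Phi\}$; writing $\Phi:X\leadsto Y$ means that $\Phi(x)\neq\varnothing$ for every $x\in X$. $\Phi$ is open if it is an open subset of the product space $X\times Y$, and convex-valued if each $\Phi(x)$ is convex. A selection for $\Phi:X\leadsto Y$ is a map $f:X\to Y$ with $f(x)\in\Phi(x)$ for every $x\in X$. A function $\xi:X\to\mathbb{R}$ is lower (upper) semicontinuous if $\{x\in X:\xi(x)>r\}$ (respectively, $\{x\in X:\xi(x)<r\}$) is open in $X$ for every $r\in\mathbb{R}$. For functions $\xi,\eta:X\to\mathbb{R}$, $\xi<\eta$ means $\xi(x)<\eta(x)$ for every $x\in X$. *)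

(* Defs.v *)
From mathcomp Require Import all_boot all_order all_algebra.
From mathcomp Require Import boolp classical_sets reals ereal topology normedtype convex.

Set Implicit Arguments.
Unset Strict Implicit.
Unset Printing Implicit Defensive.

Import Order.TTheory GRing.Theory Num.Theory.
Import numFieldTopology.Exports numFieldNormedType.Exports.

Local Open Scope classical_set_scope.
Local Open Scope ring_scope.

(* A relation between X and Y is a set Phi : set (X * Y); its value Phi(x) is
   the section [xsection Phi x]. *)
Definition nonempty_valued (X Y : Type) (Phi : set (X * Y)) : Prop :=
  forall x, xsection Phi x !=set0.

Definition convex_valued (R : numDomainType) (X : Type) (M : lmodType R)
    (Phi : set (X * M)) : Prop :=
  forall x, convex_set (xsection Phi x : set (convex_lmodType M)).

Definition selection (X Y : Type) (Phi : set (X * Y)) (f : X -> Y) : Prop :=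
  forall x, xsection Phi x (f x).

(* The library's [lower_semicontinuous] is for functions with values in \bar R
   only, and it has no upper counterpart. *)
Definition real_lower_semicontinuous (R : realType) (X : topologicalType)
    (f : X -> R) : Prop :=
  forall r : R, open [set x | r < f x].

Definition real_upper_semicontinuous (R : realType) (X : topologicalType)
    (f : X -> R) : Prop :=
  forall r : R, open [set x | f x < r].

Lemma real_lower_semicontinuousE (R : realType) (X : topologicalType)
    (f : X -> R) :
  real_lower_semicontinuous f <-> lower_semicontinuous (EFin \o f).
Proof.
apply: (iff_trans _ (iff_sym (lower_semicontinuousP _))).
by split=> h a; have := h a; under eq_set do rewrite /= ?lte_fin.
Qed.

Lemma real_upper_semicontinuousN (R : realType) (X : topologicalType)
    (f : X -> R) :
  real_upper_semicontinuous f <-> real_lower_semicontinuous (fun x => - f x).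
Proof.
split=> h r; have := h (- r).
- by under eq_set do rewrite ltrNr.
- by under eq_set do rewrite ltrN2.
Qed.

(* Main.v *)
Require Import Defs.
From mathcomp Require Import all_boot all_order all_algebra.
From mathcomp Require Import boolp classical_sets reals ereal topology normedtype convex.
From mathcomp Require Import interval_inference trigo ring lra.

(** The equivalence rests on the correspondence between open convex-valued
    relations into the line and pairs of semicontinuous bounds.

    Given [xi < eta], the relation [{(x, y) | xi x < y < eta x}] is open
    ([open_between]): a point strictly above an upper semicontinuous function
    stays above it when both the argument and the point move a little. Its
    values are nonempty intervals and its selections are the functions strictly
    between [xi] and [eta].

    Conversely, the values of an open convex-valued [Phi] are open intervals,
    whose endpoints may be infinite. Since (b) speaks of real-valued bounds, the
    line is first squeezed by [atan] into a bounded interval. The bounds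
    [xi x = inf (atan @` Phi x)] and [eta x = sup (atan @` Phi x)] are
    semicontinuous because the horizontal sections of [Phi] are open
    ([usc_inf_image], [lsc_sup_image]), and [xi < eta] because the vertical
    sections are open ([open_between_points]). A continuous [f] with
    [xi < f < eta] stays inside the open interval on which [tan] inverts
    [atan], even where [xi] or [eta] reaches an endpoint of it, so [tan \o f] is
    continuous, and convexity places its values in [Phi]. *)

Set Implicit Arguments.
Unset Strict Implicit.
Unset Printing Implicit Defensive.

Import Order.TTheory GRing.Theory Num.Theory.
Import numFieldTopology.Exports numFieldNormedType.Exports.

Local Open Scope classical_set_scope.
Local Open Scope ring_scope.

Lemma convex_set_intervalP (R : realFieldType) (A : set R) :
  convex_set (A : set (convex_lmodType R^o)) <-> is_interval A.
Proof.
split=> [cA|iA].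
- apply/is_intervalPlt => x y Ax Ay z /andP[xz zy].
  have xy : 0 < y - x by rewrite subr_gt0 (lt_trans xz).
  have t0 : 0 <= (y - z) / (y - x) by rewrite divr_ge0 ?subr_ge0 // ltW // -subr_gt0.
  have t1 : (y - z) / (y - x) <= 1.
    by rewrite ler_pdivrMr// mul1r lerD2l lerN2 ltW.
  have := cA _ _ (Itv01 t0 t1) (mem_set Ax) (mem_set Ay).
  rewrite inE; congr A.
  rewrite [LHS](convRE (x : R^o) (y : R^o)) /= /unstable.onem; field.
  by rewrite gt_eqF.
- move=> x y t; rewrite !inE => Ax Ay.
  have [xy|/ltW yx] := leP (x : R) y.
  + by apply: (iA _ _ Ax Ay); have := convR_itv t xy; rewrite in_itv.
  + apply: (iA _ _ Ay Ax); rewrite convC; move: {t}(_%:i01) => t.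
    by have := convR_itv t yx; rewrite in_itv.
Qed.

Lemma open_xsection (X Y : topologicalType) (Phi : set (X * Y)) (x : X) :
  open Phi -> open (xsection Phi x).
Proof.
move=> oPhi; rewrite xsectionE.
apply: open_comp => // y _.
by apply: cvg_pair; [exact: cvg_cst|exact: cvg_id].
Qed.

Lemma open_ysection (X Y : topologicalType) (Phi : set (X * Y)) (y : Y) :
  open Phi -> open (ysection Phi y).
Proof.
move=> oPhi; rewrite ysectionE.
apply: open_comp => // x _.
by apply: cvg_pair; [exact: cvg_id|exact: cvg_cst].
Qed.

Lemma open_between_points (R : realFieldType) (U : set R) (y : R) :
  open U -> U y -> exists a b, [/\ U a, U b, a < y & y < b].
Proof.
rewrite openE => oU /oU /nbhs_ballP[e /= e0 yeU].
exists (y - e / 2), (y + e / 2); split; [| |lra|lra]; apply: yeU.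
- by rewrite /ball/= opprB addrC subrK gtr0_norm; lra.
- by rewrite /ball/= opprD addrA subrr sub0r normrN gtr0_norm; lra.
Qed.

Lemma open_between (R : realType) (X : topologicalType) (xi eta : X -> R) :
  real_upper_semicontinuous xi -> real_lower_semicontinuous eta ->
  open [set p : X * R | xi p.1 < p.2 < eta p.1].
Proof.
move=> usc lsc; rewrite openE => -[x y] /= /andP[xiy yeta].
have [r /andP[xir ry]] : exists r, xi x < r < y.
  by exists ((xi x + y) / 2); lra.
have [s /andP[ys seta]] : exists s, y < s < eta x.
  by exists ((y + eta x) / 2); lra.
(* The box {xi < r} /\ {s < eta} times ]r, s[ lies inside the relation. *)
exists ([set x' | xi x' < r] `&` [set x' | s < eta x'],
        [set y' | r < y'] `&` [set y' | y' < s]) => /=.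
  split; apply: filterI; apply: open_nbhs_nbhs; split=> //.
by move=> [x' y'] /= [[? ?] [? ?]]; apply/andP; split; lra.
Qed.

(** [inf] is below [r] as soon as one value is, so the strict sublevel set is
    a union of horizontal sections. *)
Lemma usc_inf_image (R : realType) (X Y : topologicalType)
    (Phi : set (X * Y)) (h : Y -> R) :
  open Phi -> nonempty_valued Phi -> has_lbound (range h) ->
  real_upper_semicontinuous (fun x => inf (h @` xsection Phi x)).
Proof.
move=> oPhi nPhi [l hl] r.
suff -> : [set x | inf (h @` xsection Phi x) < r]
          = \bigcup_(y in [set y | h y < r]) ysection Phi y.
  by apply: bigcup_open => y _; exact: open_ysection.
apply/seteqP; split=> [x /= /inf_lt|x [y /= hy]].
- case=> [|_ [y Phixy <-] hyr]; first exact: image_nonempty.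
  by exists y => //; move: Phixy; rewrite /xsection /ysection /= !inE.
- rewrite /ysection /= inE => Phixy; apply: le_lt_trans hy.
  apply: ge_inf; first by exists l => _ [z _ <-]; apply: hl; exists z.
  by exists y => //; rewrite /xsection /= inE.
Qed.

Lemma lsc_sup_image (R : realType) (X Y : topologicalType)
    (Phi : set (X * Y)) (h : Y -> R) :
  open Phi -> nonempty_valued Phi -> has_ubound (range h) ->
  real_lower_semicontinuous (fun x => sup (h @` xsection Phi x)).
Proof.
move=> oPhi nPhi [u hu].
suff -> : (fun x => sup (h @` xsection Phi x))
          = (fun x => - inf ((fun y => - h y) @` xsection Phi x)).
  apply/real_upper_semicontinuousN; apply: usc_inf_image => //.
  by exists (- u) => _ [y _ <-]; rewrite lerN2; apply: hu; exists y.
apply/funext => x; rewrite /inf opprK image_comp.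
by congr (sup (_ @` _)); apply/funext => y /=; rewrite opprK.
Qed.

(** The key step from (b) to (a): a function squeezed between the [atan]-images
    of the values of [Phi] is carried back by [tan] to a selection. *)
Lemma tan_selection (R : realType) (X : topologicalType) (Phi : set (X * R))
    (f : X -> R) :
  nonempty_valued Phi -> (forall x, is_interval (xsection Phi x)) ->
  continuous f ->
  (forall x, inf (@atan R @` xsection Phi x) < f x) ->
  (forall x, f x < sup (@atan R @` xsection Phi x)) ->
  continuous (@tan R \o f) /\ selection Phi (@tan R \o f).
Proof.
move=> nPhi iPhi cf lef gef.
have between x : exists a b,
    [/\ xsection Phi x a, xsection Phi x b, atan a < f x & f x < atan b].
  have [_ [a Phia <-] af] := inf_lt (image_nonempty _ (nPhi x)) (lef x).
  have [_ [b Phib <-] fb] := sup_gt (image_nonempty _ (nPhi x)) (gef x).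
  by exists a, b.
have fpi x : f x \in `](- (pi / 2)), (pi / 2)[.
  have [a [b [_ _ af fb]]] := between x.
  by rewrite in_itv/= (lt_trans (atan_gtNpi2 a) af) (lt_trans fb (atan_ltpi2 b)).
split=> [x|x].
- apply: continuous_comp; first exact: cf.
  apply: continuous_tan; rewrite gt_eqF// cos_gt0_pihalf//.
  by have := fpi x; rewrite in_itv.
- have [a [b [Phia Phib af fb]]] := between x.
  apply: (iPhi x _ _ Phia Phib).
  have apihalf c : @atan R c \in `](- (pi / 2)), (pi / 2)[.
    by rewrite in_itv/= atan_gtNpi2 atan_ltpi2.
  rewrite -[a]atanK -[b]atanK /=.
  by rewrite !ltW// ltr_tan.
Qed.

(* [R^o] is [R] seen as a module over itself. *)
Theorem proposition4p3 (R : realType) (X : topologicalType)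
    (hX : hausdorff_space X) :
  (forall Phi : set (X * R),
      open Phi ->
      nonempty_valued Phi ->
      convex_valued (Phi : set (X * R^o)) ->
      exists f : X -> R, continuous f /\ selection Phi f)
  <->
  (forall xi eta : X -> R,
      real_upper_semicontinuous xi ->
      real_lower_semicontinuous eta ->
      (forall x : X, xi x < eta x) ->
      exists f : X -> R,
        continuous f /\ (forall x : X, xi x < f x /\ f x < eta x)).
Proof.
split=> [sel xi eta usc lsc xieta|sandwich Phi oPhi nPhi cPhi].
- have [||f [cf self]] := sel _ (open_between usc lsc).
  + move=> x; exists ((xi x + eta x) / 2); rewrite xsectionE /=.
    by have := xieta x; lra.
  + move=> x; apply/convex_set_intervalP => y z.
    by rewrite xsectionE /= => ? ? w; lra.
  + exists f; split=> // x.
    by have := self x; rewrite xsectionE /= => /andP.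
- have lb : has_lbound (range (@atan R)).
    by exists (- (pi / 2)) => _ [y _ <-]; rewrite ltW// atan_gtNpi2.
  have ub : has_ubound (range (@atan R)).
    by exists (pi / 2) => _ [y _ <-]; rewrite ltW// atan_ltpi2.
  have [|f [cf fP]] := sandwich _ _ (usc_inf_image oPhi nPhi lb)
                                    (lsc_sup_image oPhi nPhi ub).
    move=> x; have [y Phiy] := nPhi x.
    have [a [b [Phia Phib ay yb]]] :=
      open_between_points (open_xsection x oPhi) Phiy.
    apply: (@le_lt_trans _ _ (atan a)).
      apply: ge_inf; last by exists a.
      by apply: subset_has_lbound lb; exact: image_subset.
    apply: (@lt_le_trans _ _ (atan b)); first by rewrite lt_atan// (lt_trans ay).
    apply: ub_le_sup; last by exists b.
    by apply: subset_has_ubound ub; exact: image_subset.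
  exists (@tan R \o f); apply: tan_selection => // x.
  + by apply/convex_set_intervalP; exact: cPhi.
  + by have [] := fP x.
  + by have [] := fP x.
Qed.
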